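(* Let $G$ be a finite non-cyclic group. Let $a, b \in G$ be such that $a \nsim b$ in $\mathscr{P}(G)$ and $N_a \neq N_b$. Then the following statements are equivalent: (1) $a \sim b$ in $\mathscr{P}_e(G)$; (2) there exists $c \in G$ such that $a \sim c$ and $b \sim c$ in $\mathscr{P}(G)$ and $N_c \geq \max\{N_a, N_b\}$.
   Context: For a group $G$, the power graph $\mathscr{P}(G)$ is the simple graph with vertex set $G$ in which two distinct vertices $a,b$ are adjacent if and only if $\langle a\rangle \subseteq \langle b\rangle$ or $\langle b\rangle \subseteq \langle a\rangle$. The enhanced power graph $\mathscr{P}_e(G)$ is the simple graph with vertex set $G$ in which two distinct vertices $a,b$ are adjacent if and only if there exists $c \in G$ with $a,b \in \langle c\rangle$. The notation $a\sim b$ means that $a$ and $b$ are adjacent in the indicated graph, and $a \nsim b$ that they are not. For $a \in G$, $N(a)$ denotes the set of neighbors of $a$ in $\mathscr{P}(G)$ (so $a\notin N(a)$), $\widetilde{N(a)} = \{b \in N(a) \mid N(a)\setminus\{b\} = N(b)\setminus\{a\}\}$ is the set of closed twins of $a$, and $N_a = |\widetilde{N(a)}| + 1$. *)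

(* Defs.v *)
From mathcomp Require Import all_boot all_fingroup all_solvable.

Set Implicit Arguments.
Unset Strict Implicit.
Unset Printing Implicit Defensive.

Local Open Scope group_scope.

Section PowerGraphs.

Variable gT : finGroupType.

(* The vertices of both graphs are the elements of a group G : {group gT}, so
   the two relations below are meant to be used on elements of G. Adjacency in
   the power graph of G depends only on the vertices. *)
Definition power_adj : rel gT := fun a b =>
  (a != b) && ((<[a]> \subset <[b]>) || (<[b]> \subset <[a]>)).

Variable G : {group gT}.

Definition enhanced_power_adj : rel gT := fun a b =>
  (a != b) && [exists c in G, (a \in <[c]>) && (b \in <[c]>)].

Definition power_nbhd (a : gT) : {set gT} := [set b in G | power_adj a b].

Definition closed_twins (a : gT) : {set gT} :=
  [set b in power_nbhd a | power_nbhd a :\ b == power_nbhd b :\ a].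

Definition twin_number (a : gT) : nat := #|closed_twins a|.+1.

End PowerGraphs.

(* Main.v *)
(** [N_a] is the size of the class of vertices with the closed neighbourhood of
    [a]. The elements of such a class generate a chain of cyclic subgroups: either
    they are the generators of [<a>], and [N_a] is the totient of [#[a]], or the
    class contains [y] and [x] with [<y> < <x>], where [<x>] contains the class.
    In the second case any [w] with [<x> < <w>] has prime power order, because
    the divisors of [#[w]] comparable with [#[y]] are those comparable with
    [#[x]]; hence the totient of [#[w]] is at least [#[x]].
    If [<c>] lies strictly below [<a>] and [<b>], then either [a] and [b] are in a
    common cyclic group [<x>], or [N_a] and [N_b] are at least [N_c]; in the latter
    case [N_c >= max N_a N_b] forces [N_a = N_b]. Conversely, if [a] and [b] lie in
    [<c>] and are not comparable, then [#[c]] is not a prime power, so [N_a] and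
    [N_b] are totients of divisors of [#[c]]. *)

Require Import Defs.
From mathcomp Require Import all_boot all_fingroup all_solvable.

Set Implicit Arguments.
Unset Strict Implicit.
Unset Printing Implicit Defensive.

(** * Totients and divisibility *)

Lemma leq_totient_dvd (m n : nat) : 0 < n -> m %| n -> totient m <= totient n.
Proof.
move=> n_gt0 mn; have m_gt0 := dvdn_gt0 n_gt0 mn.
rewrite !totientE //.
have primes_m : perm_eq (primes m) [seq p <- primes n | p %| m].
  apply: uniq_perm; rewrite ?filter_uniq ?primes_uniq // => p.
  rewrite mem_filter !mem_primes m_gt0 n_gt0 /=.
  have [pm | _] := boolP (p %| m); last by rewrite andbF.
  by rewrite (dvdn_trans pm mn) !andbT.
(* The product for [m] is extended to all primes of [n], with factor 1 at those that do not divide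
   [m]; the factors are then compared one by one. *)
rewrite (perm_big _ primes_m) big_filter big_mkcond /= !big_seq.
apply: leq_prod => p; rewrite mem_primes => /and3P[p_pr _ pn].
have p1_gt0 : 0 < p.-1 by rewrite -subn1 subn_gt0 prime_gt1.
case: ifP => _; last by rewrite muln_gt0 p1_gt0 expn_gt0 prime_gt0.
rewrite leq_mul2l leq_exp2l ?prime_gt1 //.
by rewrite -!subn1 leq_sub2r ?orbT // dvdn_leq_log.
Qed.

(** For [n = p ^ k], a proper divisor is at most [p ^ k.-1], which divides the totient
    [p.-1 * p ^ k.-1]. *)
Lemma leq_totient_ppower (p d n : nat) :
  prime p -> p.-nat n -> d %| n -> d != n -> d <= totient n.
Proof.
move=> p_pr /p_natP[k ->] /(dvdn_pfactor _ _ p_pr)[j jk ->] neq_d.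
have {neq_d}j_lt : j < k.
  by rewrite ltn_neqAle jk andbT; apply: contraNneq neq_d => ->.
rewrite totient_pfactor ?(leq_trans _ j_lt) //.
apply: leq_trans (leq_pmull _ _); last by rewrite -subn1 subn_gt0 prime_gt1.
by rewrite leq_exp2l ?prime_gt1 // -ltnS (ltn_predK j_lt).
Qed.

Definition dvdn_comparable (m n : nat) := (m %| n) || (n %| m).

(* A prime [p] with e`_p < d`_p is fixed; testing the hypothesis on the divisors
   e`_p * n`_p^', n`_p * e`_p^' and d`_p of [n] shows successively that
   n`_p^' = d`_p^', d`_p^' = e`_p^' and e`_p^' = 1. *)
Lemma ppower_of_dvdn_comparable (e d n : nat) :
    0 < n -> e %| d -> d %| n -> e != d -> d != n ->
    (forall z, z %| n -> dvdn_comparable z e = dvdn_comparable z d) ->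
  exists2 p, prime p & p.-nat n.
Proof.
move=> n_gt0 ed dn neq_ed neq_dn cmp_eq.
have d_gt0 := dvdn_gt0 n_gt0 dn; have e_gt0 := dvdn_gt0 d_gt0 ed.
have not_de : ~~ (d %| e) by apply: contra neq_ed => de; rewrite eqn_dvd ed de.
have [/allP all_p | /allPn[p]] := boolP (all (fun p : nat => d`_p %| e) (primes d)).
  by case/negP: not_de; apply/(dvdn_partP _ d_gt0) => p pd; apply: all_p.
rewrite mem_primes => /and3P[p_pr _ _] not_dpe; exists p => //.
have pgt0 (pi : nat_pred) m : 0 < m`_pi by apply: part_gt0.
have part_pp' m : m`_p`_p^' = 1 by rewrite part_p'nat // pnatNK part_pnat.
have partK m k : (m`_p * k`_p^')`_p = m`_p.
  rewrite partnM // (part_pnat_id (part_pnat p m)).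
  by rewrite (part_p'nat (part_pnat p^' k)) muln1.
have partK' m k : (m`_p * k`_p^')`_p^' = k`_p^'.
  by rewrite partnM // part_pp' mul1n part_pnat_id ?part_pnat.
have split_dvd m k : m %| n -> k %| n -> m`_p * k`_p^' %| n.
  by move=> mn kn; rewrite -[X in _ %| X](partnC p n_gt0) dvdn_mul ?partn_dvd.
have e_dvd m k : e`_p %| m -> e`_p^' %| k -> e %| m * k.
  by move=> em ek; rewrite -(partnC p e_gt0) dvdn_mul.
have en := dvdn_trans ed dn.
have not_dpep : ~~ (d`_p %| e`_p).
  by apply: contra not_dpe => /dvdn_trans; apply; apply: dvdn_part.
have n'_dvd : n`_p^' %| d`_p^'.
  have := cmp_eq _ (split_dvd _ _ en (dvdnn n)).
  rewrite /dvdn_comparable (e_dvd _ _ (dvdnn _) (partn_dvd _ n_gt0 en)) orbT.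
  case/esym/orP=> zd.
    by have := partn_dvd p^' d_gt0 zd; rewrite partK'.
  have := partn_dvd p _ zd; rewrite partK muln_gt0 !pgt0 => /(_ isT).
  by rewrite (negPf not_dpep).
have d'_dvd : d`_p^' %| e`_p^'.
  have := cmp_eq _ (split_dvd _ _ (dvdnn n) en).
  rewrite /dvdn_comparable (e_dvd _ _ (partn_dvd _ n_gt0 en) (dvdnn _)) orbT.
  case/esym/orP=> zd.
    have := partn_dvd p d_gt0 zd; rewrite partK => n_dvd.
    case/negP: neq_dn; rewrite eqn_dvd dn -(partnC p n_gt0) -(partnC p d_gt0).
    by rewrite dvdn_mul.
  by have := partn_dvd p^' _ zd; rewrite partK' muln_gt0 !pgt0 => /(_ isT).
have e'_1 : e`_p^' = 1.
  have := cmp_eq _ (dvdn_trans (dvdn_part p d) dn).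
  rewrite /dvdn_comparable dvdn_part (negPf not_dpe) /= => ez.
  have := partn_dvd p^' (pgt0 _ _) ez.
  by rewrite part_pp' dvdn1 => /eqP.
have := dvdn_trans n'_dvd d'_dvd; rewrite e'_1 dvdn1 => /eqP n'_1.
by rewrite -(partnC p n_gt0) n'_1 muln1 part_pnat.
Qed.

Local Open Scope group_scope.

(** * Twin classes as classes of cyclic subgroups with the same comparabilities *)

Section TwinClasses.

Variables (gT : finGroupType) (G : {group gT}).
Implicit Types a b c x y z w : gT.

Definition cycle_comparable a b :=
  (<[a]> \subset <[b]>) || (<[b]> \subset <[a]>).

Lemma cycle_comparableC a b : cycle_comparable a b = cycle_comparable b a.
Proof. by rewrite /cycle_comparable orbC. Qed.

Lemma cycle_comparablexx a : cycle_comparable a a.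
Proof. by rewrite /cycle_comparable subxx. Qed.

Lemma cycle_subset_dvd w x y : x \in <[w]> -> y \in <[w]> ->
  (<[x]> \subset <[y]>) = (#[x] %| #[y]).
Proof.
move=> xw yw; rewrite /order.
by rewrite (cardSg_cyclic (cycle_cyclic w)) ?cycle_subG.
Qed.

Lemma cycle_comparable_dvd w x y : x \in <[w]> -> y \in <[w]> ->
  cycle_comparable x y = dvdn_comparable #[x] #[y].
Proof.
by move=> xw yw; rewrite /cycle_comparable !(@cycle_subset_dvd w).
Qed.

Lemma cycle_comparable_ppower p w x y : prime p -> p.-nat #[w] ->
  x \in <[w]> -> y \in <[w]> -> cycle_comparable x y.
Proof.
move=> p_pr /p_natP[k ow] xw yw; rewrite (@cycle_comparable_dvd w) //.
have := order_dvdG xw; have := order_dvdG yw.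
rewrite -orderE ow => /(dvdn_pfactor _ _ p_pr)[i _ ->].
case/(dvdn_pfactor _ _ p_pr) => j _ ->.
by rewrite /dvdn_comparable !dvdn_Pexp2l ?prime_gt1 // leq_total.
Qed.

(** As comparability is reflexive, this is equality of closed neighbourhoods, without the deletions
    of [closed_twins]. *)
Definition twin_equiv a b :=
  [forall w in G, cycle_comparable a w == cycle_comparable b w].

Lemma twin_equivP a b :
  reflect {in G, forall w, cycle_comparable a w = cycle_comparable b w}
          (twin_equiv a b).
Proof.
by apply: (iffP forall_inP) => eq_ab w wG; apply/eqP; [apply: eq_ab | rewrite eq_ab].
Qed.

Definition twin_class a := [set b in G | twin_equiv a b].

Lemma twin_class_refl a : a \in G -> a \in twin_class a.
Proof. by move=> aG; rewrite inE aG; apply/twin_equivP. Qed.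

Lemma twin_classP a b : b \in twin_class a ->
  b \in G /\ {in G, forall w, cycle_comparable a w = cycle_comparable b w}.
Proof. by rewrite inE => /andP[bG /twin_equivP]. Qed.

Lemma closed_twinsE a : a \in G -> closed_twins G a = twin_class a :\ a.
Proof.
move=> aG; apply/setP=> b; rewrite !inE /power_adj -/(cycle_comparable a b).
rewrite [a == b]eq_sym.
have [-> | neq_ba] /= := eqVneq b a; first by rewrite !andbF.
have [bG | //] /= := boolP (b \in G).
apply/andP/twin_equivP => [[ab /eqP/setP eqN] w wG | eqN]; last first.
  split; first by rewrite eqN ?cycle_comparablexx.
  apply/eqP/setP=> w; rewrite !inE /power_adj.
  have [wG | _] /= := boolP (w \in G); last by rewrite !andbF.
  have /= := eqN w wG; rewrite /cycle_comparable => ->.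
  by rewrite ![_ == w]eq_sym andbCA.
have := eqN w; rewrite !inE wG /power_adj /= -/(cycle_comparable a w).
rewrite -/(cycle_comparable b w) ![_ == w]eq_sym.
(* At [w = b] and [w = a] the equality of the punctured neighbourhoods is void; there the adjacency
   [ab] gives the claim. *)
have [-> | _] := eqVneq w b; first by rewrite cycle_comparablexx.
have [-> | _] //= := eqVneq w a.
by rewrite cycle_comparablexx cycle_comparableC ab.
Qed.

Lemma twin_numberE a : a \in G -> twin_number G a = #|twin_class a|.
Proof.
move=> aG; rewrite /twin_number closed_twinsE //.
by rewrite [RHS](cardsD1 a) twin_class_refl.
Qed.

Lemma leq_totient_twin_number a : a \in G -> totient #[a] <= twin_number G a.
Proof.
move=> aG; rewrite twin_numberE // totient_gen subset_leq_card //.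
apply/subsetP=> b; rewrite !inE /generator => /eqP eq_ab.
rewrite -cycle_subG -eq_ab cycle_subG aG /=.
by apply/twin_equivP=> w _; rewrite /cycle_comparable eq_ab.
Qed.

Lemma twin_number_totient a : a \in G ->
  {in twin_class a, forall z, <[z]> = <[a]>} -> twin_number G a = totient #[a].
Proof.
move=> aG gen_a; apply/eqP; rewrite eqn_leq leq_totient_twin_number // andbT.
rewrite twin_numberE // totient_gen subset_leq_card //.
by apply/subsetP=> b /gen_a; rewrite inE /generator => ->.
Qed.

(* Comparability inside [<[w]>] is comparability of orders for divisibility, and
   every divisor of [#[w]] is an order. *)
Lemma twin_equiv_ppower y x w : w \in G -> twin_equiv y x ->
    <[y]> \proper <[x]> -> <[x]> \proper <[w]> ->
  exists2 p, prime p & p.-nat #[w].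
Proof.
move=> wG /twin_equivP eq_yx pyx pxw.
have xw : x \in <[w]> by rewrite -cycle_subG proper_sub.
have yw : y \in <[w]>.
  by rewrite -cycle_subG (subset_trans (proper_sub pyx)) // proper_sub.
apply: (@ppower_of_dvdn_comparable #[y] #[x]) => //.
- exact: cardSg (proper_sub pyx).
- exact: order_dvdG.
- by rewrite neq_ltn (proper_card pyx).
- by rewrite neq_ltn (proper_card pxw).
move=> m mw; pose z := w ^+ (#[w] %/ m).
have zw : z \in <[w]> by apply: mem_cycle.
have oz : #[z] = m.
  by rewrite orderXdiv ?dvdn_div // divnA // mulKn.
have zG : z \in G by apply: groupX.
rewrite -oz -!(@cycle_comparable_dvd w) // ![cycle_comparable z _]cycle_comparableC.
exact: eq_yx.
Qed.

Lemma twin_class_comparable a x y :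
  x \in twin_class a -> y \in twin_class a -> cycle_comparable x y.
Proof.
move=> /twin_classP[xG eqx] /twin_classP[yG eqy].
by rewrite -eqx // eqy // cycle_comparablexx.
Qed.

Lemma twin_class_equiv a x y :
  x \in twin_class a -> y \in twin_class a -> twin_equiv x y.
Proof.
move=> /twin_classP[_ eqx] /twin_classP[_ eqy].
by apply/twin_equivP=> w wG; rewrite -eqx // eqy.
Qed.

(** The cyclic groups of a class form a chain, so a member of maximal order generates the largest
    one. *)
Lemma twin_class_top a : a \in G ->
  exists2 x, x \in twin_class a & {in twin_class a, forall z, z \in <[x]>}.
Proof.
move=> aG; have [x xa max_x] := arg_maxnP (@order gT) (twin_class_refl aG).
exists x => // z za; have /orP[|xz] := twin_class_comparable za xa.
  by rewrite cycle_subG.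
have /eqP -> : <[x]> == <[z]> by rewrite eqEcard xz; apply: max_x.
exact: cycle_id.
Qed.

Lemma twin_number_cycle a : a \in G ->
    ~~ [forall z in twin_class a, <[z]> == <[a]>] ->
  exists x y, [/\ x \in twin_class a, y \in twin_class a, a \in <[x]>,
    <[y]> \proper <[x]> & twin_number G a <= #[x]].
Proof.
move=> aG /forall_inPn[z za neq_za]; have [x xa sub_x] := twin_class_top aG.
have leNx : twin_number G a <= #[x].
  by rewrite twin_numberE // subset_leq_card //; apply/subsetP.
have ax : a \in <[x]> by rewrite sub_x ?twin_class_refl.
(* The element strictly below [x] is [a] itself, unless [a] also generates [<[x]>]; then it is
   [z]. *)
have [xa_eq | neq_ax] := eqVneq <[a]> <[x]>; last first.
  by exists x, a; rewrite twin_class_refl // properEneq neq_ax cycle_subG.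
exists x, z; split=> //.
by rewrite properEneq cycle_subG sub_x // andbT -xa_eq.
Qed.

Lemma power_adj_enhanced_leq a b c :
    c \in G -> a \in <[c]> -> b \in <[c]> -> ~~ cycle_comparable a b ->
  twin_number G a <= twin_number G c.
Proof.
move=> cG ac bc not_ab; have aG : a \in G by apply: subsetP ac; rewrite cycle_subG.
have bG : b \in G by apply: subsetP bc; rewrite cycle_subG.
have [/forall_inP gen_a | ] := boolP [forall z in twin_class a, <[z]> == <[a]>].
  rewrite twin_number_totient // => [|z /gen_a/eqP //].
  apply: leq_trans (leq_totient_twin_number cG).
  by rewrite leq_totient_dvd // order_dvdG.
case/twin_number_cycle=> // x [y [xa ya ax pyx _]].
have [xG eq_x] := twin_classP xa.
(* If [<[c]>] were inside [<[x]>], then [b] would be comparable with [x], hence with its twin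
   [a]. *)
have pxc : <[x]> \proper <[c]>.
  have cmp_xc : cycle_comparable x c.
    by rewrite -eq_x // /cycle_comparable !cycle_subG ac.
  have not_cx : ~~ (<[c]> \subset <[x]>).
    apply: contra not_ab => cx; rewrite eq_x // cycle_comparableC.
    by rewrite /cycle_comparable cycle_subG (subsetP cx).
  rewrite properE not_cx andbT; move: cmp_xc.
  by rewrite /cycle_comparable (negPf not_cx) orbF.
(* Subgroups of a cyclic [p]-group form a chain, which contradicts the incomparability of [a] and
   [b]. *)
have [p p_pr pc] := twin_equiv_ppower cG (twin_class_equiv ya xa) pyx pxc.
by case/negP: not_ab; apply: cycle_comparable_ppower pc _ _.
Qed.

End TwinClasses.

Theorem theorem4p2 (gT : finGroupType) (G : {group gT}) (a b : gT)
    (ncG : ~~ cyclic G) (aG : a \in G) (bG : b \in G)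
    (nadj_ab : ~~ power_adj a b)
    (neqN : twin_number G a <> twin_number G b) :
  enhanced_power_adj G a b <->
  exists c : gT, [/\ c \in G, power_adj a c, power_adj b c
    & maxn (twin_number G a) (twin_number G b) <= twin_number G c].
Proof.
have neq_ab : a != b by apply/eqP=> eq_ab; apply: neqN; rewrite eq_ab.
have {nadj_ab} not_ab : ~~ cycle_comparable a b.
  by move: nadj_ab; rewrite /power_adj neq_ab.
have not_ba : ~~ cycle_comparable b a by rewrite cycle_comparableC.
rewrite /enhanced_power_adj neq_ab /=; split.
  (* The generator of the common cyclic group serves as [c]; it differs from [a] and [b], since
     otherwise these would be comparable. *)
  case/exists_inP=> c cG /andP[ac bc]; exists c; split=> //.
  - rewrite /power_adj !cycle_subG ac andbT; apply: contraNneq not_ba => ->.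
    by rewrite /cycle_comparable cycle_subG bc.
  - rewrite /power_adj !cycle_subG bc andbT; apply: contraNneq not_ab => ->.
    by rewrite /cycle_comparable cycle_subG ac.
  by rewrite geq_max (power_adj_enhanced_leq cG ac bc) ?(power_adj_enhanced_leq cG bc ac).
case=> c [cG /andP[_ cmp_ac] /andP[_ cmp_bc]]; rewrite geq_max => /andP[leNa leNb].
apply/exists_inP.
have common (w u v : gT) : ~~ cycle_comparable u v -> cycle_comparable v w ->
    u \in <[w]> -> v \in <[w]>.
  move=> not_uv; rewrite /cycle_comparable !cycle_subG => /orP[//|wv] uw.
  case/negP: not_uv; rewrite /cycle_comparable cycle_subG.
  by rewrite (subsetP _ _ uw) ?cycle_subG.
(* An element comparable with both lies above both or strictly below both: [<[w]>] between them
   would make [a] and [b] comparable. *)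
have below w : w \in G -> cycle_comparable a w -> cycle_comparable b w ->
    (exists2 c, c \in G & (a \in <[c]>) && (b \in <[c]>)) \/
    (<[w]> \proper <[a]> /\ <[w]> \proper <[b]>).
  move=> wG aw bw; have [aw_in | aw_out] := boolP (a \in <[w]>).
    by left; exists w; rewrite // aw_in (common _ a).
  have [bw_in | bw_out] := boolP (b \in <[w]>).
    by left; exists w; rewrite // bw_in (common _ b).
  right; move: aw bw; rewrite /cycle_comparable !properE !(cycle_subG, aw_out, bw_out).
  by rewrite (negPf aw_out) (negPf bw_out) /= !andbT.
have [// | [pca pcb]] := below c cG cmp_ac cmp_bc.
have eqN : twin_number G c <= twin_number G a -> twin_number G c <= twin_number G b ->
    twin_number G a = twin_number G b.
  move=> geNa geNb; apply/eqP.
  by rewrite eqn_leq (leq_trans leNa geNb) (leq_trans leNb geNa).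
have [/forall_inP gen_c | ] := boolP [forall z in twin_class G c, <[z]> == <[c]>].
  have Nc : twin_number G c = totient #[c].
    by apply: twin_number_totient => // z /gen_c/eqP.
  have geNc u : u \in G -> <[c]> \proper <[u]> -> twin_number G c <= twin_number G u.
    move=> uG pcu; rewrite Nc; apply: leq_trans (leq_totient_twin_number uG).
    by rewrite leq_totient_dvd // cardSg // proper_sub.
  by case: neqN; rewrite eqN // geNc.
case/twin_number_cycle=> // x [y [xc yc _ pyx leNx]].
have [xG eq_x] := twin_classP xc.
(* The dichotomy [below] is applied again, now to the top [x] of the class of [c]. *)
have cmp_x u : u \in G -> cycle_comparable u c -> cycle_comparable u x.
  by move=> uG; rewrite cycle_comparableC eq_x // cycle_comparableC.
have [// | [pxa pxb]] := below x xG (cmp_x a aG cmp_ac) (cmp_x b bG cmp_bc).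
case: neqN.
(* Here [#[u]] is a prime power, so the totient of [#[u]] is at least [#[x]], which bounds the whole
   class of [c]. *)
have geNx u : u \in G -> <[x]> \proper <[u]> -> twin_number G c <= twin_number G u.
  move=> uG pxu; apply: leq_trans leNx _.
  have [p p_pr pu] := twin_equiv_ppower uG (twin_class_equiv yc xc) pyx pxu.
  apply: leq_trans (leq_totient_twin_number uG).
  apply: leq_totient_ppower p_pr pu _ _; first exact: cardSg (proper_sub pxu).
  by rewrite neq_ltn (proper_card pxu).
by rewrite eqN // geNx.
Qed.
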